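(* Let $n$ be a positive integer and let $\mathbf{S}_n$ be the symmetric group on $n$ letters. The following are equivalent: (1) $n = 1$ or $2$; (2) $\mathbf{S}_n$ is fully realizable; (3) $\mathbf{S}_n$ is simple.
   Context: Rings are associative with identity and ring homomorphisms preserve the identity. $R^\times$ is the group of units of a ring $R$; a ring endomorphism $\psi$ of $R$ restricts to a group endomorphism $\psi^\times$ of $R^\times$. A group $G$ is fully realizable if there is a ring $R$ with $R^\times = G$ (up to isomorphism) such that every group endomorphism of $G$ is of the form $\psi^\times$ for some ring endomorphism $\psi$ of $R$. A nontrivial group $G$ is said to be simple if its only normal subgroups are the trivial group and $G$ itself.
   Formalization: Condition (3) is read as ''S_n is trivial or simple'': with simple groups required to be nontrivial, the equivalence fails at n = 1, where (1) and (2) hold but S_1 is trivial; for n ≥ 2 nothing changes. *)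

(* Defs.v *)
From HB Require Import structures.
From mathcomp Require Import all_boot all_order all_algebra.
From mathcomp Require Import all_fingroup all_solvable.

Set Implicit Arguments.
Unset Strict Implicit.
Unset Printing Implicit Defensive.

Import GRing.Theory.
Local Open Scope ring_scope.

(* GRing.unit would require a unitRingType, i.e. a nonzero ring with a boolean
   test for invertibility; here R is an arbitrary ring, possibly the zero ring. *)
Definition invertible (R : pzRingType) (r : R) : Prop :=
  exists s : R, r * s = 1 /\ s * r = 1.

(* i is an isomorphism from G onto R^x, seen as a map with values in R.  That
   i 1 = 1 follows, as i 1 is invertible and idempotent. *)
Definition isom_units (G : groupType) (R : pzRingType) (i : G -> R) : Prop :=
  [/\ forall x y : G, i (x * y)%g = i x * i y,
      injective i
    & forall r : R, invertible r <-> exists x : G, i x = r].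

(* psi (i x) = i (f x) says that psi^x is f under the identification i.  The
   existence of the psi's does not depend on i, since f ranges over all
   endomorphisms of G and two choices of i differ by an automorphism of G. *)
Definition fully_realizable (G : groupType) : Prop :=
  exists (R : pzRingType) (i : G -> R),
    isom_units i /\
    forall f : {multiplicative G -> G},
      exists psi : {rmorphism R -> R}, forall x : G, psi (i x) = i (f x).

(* Main.v *)
Require Import Defs.
From HB Require Import structures.
From mathcomp Require Import all_boot all_order all_algebra.
From mathcomp Require Import all_fingroup all_solvable.

(* Suppose S_n, n >= 3, is fully realized by R.  The trivial endomorphism is
   induced by a psi sending -1 to 1, so R has characteristic 2.  Hence for a
   subgroup K of odd order, the sum e of its elements is idempotent; if g
   normalizes K, then 1 - e + e g is a unit with inverse 1 - e + e g^-1, so it is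
   an element z of S_n.  Every endomorphism that kills K sends e to 1, hence
   agrees on z and g; applied to the sign map, this makes z odd when g is odd.
   Moreover z commutes with every h that normalizes K and commutes with g modulo
   K.  If n <> 5, take for K a group generated by a 3-cycle and for g a
   transposition inverting it: z commutes with S_3 and with the permutations of
   the other n - 3 <> 2 points, so z = 1.  If n = 5, take a 5-cycle and a 4-cycle
   normalizing it: z is a power of the 5-cycle.  Both contradict the oddness of z.
   Conversely, S_1 is the unit group of F_2 and S_2 that of the dual numbers
   F_2[x]/(x^2), where x |-> 0 induces the trivial endomorphism. *)

Set Implicit Arguments.
Unset Strict Implicit.
Unset Printing Implicit Defensive.

Import GRing.Theory.

(** * Idempotents attached to subgroups of odd order *)

Section OddSubgroup.

Local Open Scope ring_scope.

Variables (gT : finGroupType) (R : pzRingType) (i : gT -> R).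
Hypothesis iM : forall x y : gT, i (x * y)%g = i x * i y.
Hypothesis i1 : i 1%g = 1.
Hypothesis char2 : 1 + 1 = 0 :> R.
Variable K : {group gT}.
Hypothesis oddK : odd #|K|.

Let e := \sum_(x in K) i x.

Lemma natr_card_odd : #|K|%:R = 1 :> R.
Proof.
rewrite -(odd_double_half #|K|) oddK -muln2 natrD natrM.
by rewrite [2%:R]char2 mulr0 addr0.
Qed.

Lemma mul_sum_subgroup k : k \in K -> e * i k = e.
Proof.
move=> Kk; rewrite /e mulr_suml (reindex_inj (mulIg k^-1%g)) /=.
rewrite (eq_bigl [in K]) => [|x]; last by rewrite groupMr ?groupV.
by apply: eq_bigr => x _; rewrite -iM mulgKV.
Qed.

Lemma sum_subgroup_idem : e * e = e.
Proof.
rewrite {2}/e mulr_sumr (eq_bigr (fun=> e)) => [|x]; last exact: mul_sum_subgroup.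
by rewrite sumr_const -mulr_natr natr_card_odd mulr1.
Qed.

Lemma sum_subgroup_comm h : h \in 'N(K)%g -> i h * e = e * i h.
Proof.
move=> Nh; rewrite /e mulr_sumr mulr_suml (reindex_inj (conjg_inj h)) /=.
rewrite (eq_bigl [in K]) => [|x]; last by rewrite memJ_norm.
by apply: eq_bigr => x _; rewrite -!iM conjgE !mulgA mulgV mul1g.
Qed.

(** Since [e] is an idempotent commuting with [i x] for [x] in the normalizer, [1 - e + e * i x]
    acts as 1 on the [1 - e] part and as [i x] on the [e] part, so it is multiplicative in [x]. *)
Lemma twist_invertible g : g \in 'N(K)%g -> invertible (1 - e + e * i g).
Proof.
have twistM x y : x \in 'N(K)%g ->
  (1 - e + e * i x) * (1 - e + e * i y) = 1 - e + e * i (x * y)%g.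
  move=> Nx; have ee := sum_subgroup_idem.
  have eu : e * (1 - e + e * i y) = e * i y.
    by rewrite mulrDr mulrBr mulr1 mulrA ee subrr add0r.
  rewrite mulrDl mulrBl mul1r eu -(sum_subgroup_comm Nx).
  rewrite -[i x * e * _]mulrA eu.
  by rewrite addrK mulrA (sum_subgroup_comm Nx) iM mulrA.
move=> Ng; exists (1 - e + e * i g^-1%g).
by rewrite !twistM ?groupV // mulgV mulVg i1 mulr1 subrK.
Qed.

End OddSubgroup.

Section OddNormalizer.

Local Open Scope ring_scope.

Lemma fully_realizable_odd_subgroup (gT : finGroupType) (K : {group gT}) (g : gT) :
  fully_realizable gT -> odd #|K| -> g \in 'N(K)%g ->
  exists z : gT,
    (forall h, h \in 'N(K)%g -> [~ h, g]%g \in K -> commute z h) /\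
    forall f : {multiplicative gT -> gT},
      (forall k, k \in K -> f k = 1%g) -> f z = f g.
Proof.
case=> R [i [[iM injI iU] endo]] oddK Ng.
have i1 : i 1%g = 1.
  have [|s [s1 _]] := (iU (i 1%g)).2; first by exists 1%g.
  by rewrite -[LHS]mulr1 -s1 mulrA -iM mulg1.
have char2 : 1 + 1 = 0 :> R.
  have [|x ix] := (iU (- 1)).1; first by exists (- 1); rewrite mulrNN mulr1.
  pose triv (_ : gT) := 1%g : gT.
  have trivM : {morph triv : x y / (x * y)%g} by move=> ? ?; rewrite /triv mulg1.
  pose tf : {multiplicative gT -> gT} :=
    HB.pack triv (isMultiplicative.Build gT gT triv trivM).
  have [psi psiE] := endo tf; have := psiE x.
  by rewrite ix rmorphN rmorph1 i1 => N1; rewrite -{1}N1 addNr.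
have [z iz] := (iU _).1 (twist_invertible iM i1 char2 oddK Ng).
set e := \sum_(x in K) i x in iz.
exists z; split=> [h Nh Khg | f fK].
  have Ngh : (g * h)%g \in 'N(K)%g by rewrite groupM.
  (* As [h * g] is [g * h] times [[~ h, g]], moving [e] past [g * h] lets it absorb the
     commutator. *)
  have hgE : e * i (h * g)%g = e * i (g * h)%g.
    rewrite commgC iM mulrA -(sum_subgroup_comm iM Ngh) -mulrA.
    by rewrite (mul_sum_subgroup iM Khg).
  apply: injI; rewrite !iM iz mulrDl mulrDr mulrBl mulrBr mul1r mulr1.
  rewrite mulrA (sum_subgroup_comm iM Nh); congr (_ + _).
  by rewrite -!mulrA -!iM hgE.
have [psi psiE] := endo f; apply: injI; rewrite -!psiE iz.
rewrite rmorphD rmorphB rmorph1 rmorphM rmorph_sum (eq_bigr (fun=> 1)).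
  by rewrite sumr_const (natr_card_odd char2 oddK) subrr add0r mul1r.
by move=> k Kk; rewrite psiE fK.
Qed.

End OddNormalizer.

(** * Symmetric groups on more than two letters *)

Lemma odd_perm_odd_order (T : finType) (s : {perm T}) :
  odd #[s]%g -> odd_perm s = false.
Proof.
move=> os; have : odd_perm (s ^+ #[s])%g = false by rewrite expg_order odd_perm1.
have -> m : odd_perm (s ^+ m)%g = odd m && odd_perm s.
  by elim: m => [|m IHm]; rewrite ?odd_perm1 // expgS odd_permM IHm /=;
    case: odd_perm; case: odd.
by rewrite os.
Qed.

Lemma fully_realizable_Sn_odd n (c g : 'S_n) :
  1 < n -> fully_realizable 'S_n -> odd #[c]%g -> g \in 'N(<[c]>)%g -> odd_perm g ->
  exists2 z : 'S_n, odd_perm z &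
    forall h, h \in 'N(<[c]>)%g -> [~ h, g]%g \in <[c]>%g -> commute z h.
Proof.
case: n c g => [|[|n]] // c g _ frS oc Ng og.
have [z [zC zf]] := fully_realizable_odd_subgroup frS oc Ng.
exists z => //.
(* The sign map becomes an endomorphism [sg] once the signs are embedded as the powers of a
   transposition [t]; as [t] is nontrivial, equal values of [sg] mean equal parities. *)
pose t : 'S_n.+2 := tperm ord0 ord_max.
have ot : odd_perm t by rewrite odd_tperm.
pose sg (s : 'S_n.+2) : 'S_n.+2 := (t ^+ odd_perm s)%g.
have sgM : {morph sg : x y / (x * y)%g}.
  by move=> x y; rewrite /sg odd_permM; do 2!case: odd_perm;
    rewrite ?mulg1 ?mul1g //= tperm2.
pose f : {multiplicative 'S_n.+2 -> 'S_n.+2} :=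
  HB.pack sg (isMultiplicative.Build _ _ sg sgM).
have : f z = f g.
  apply: zf => k Kk; rewrite /f /= /sg odd_perm_odd_order //.
  exact: dvdn_odd (order_dvdG Kk) oc.
rewrite /f /= /sg og; case: (odd_perm z) => // t1.
by move: ot; rewrite -[t]expg1 -t1 odd_perm1.
Qed.

(** Commuting with a transposition forces [z] to preserve its support. *)
Lemma commute_tperm (T : finType) (z : {perm T}) (x y : T) :
  x != y -> commute z (tperm x y) -> z x = x \/ z x = y.
Proof.
move=> xy zt.
have : tperm x y (z x) = z y by rewrite -permM zt permM tpermL.
by case: tpermP => [-> | -> | _ _ /perm_inj xy']; [left | right | rewrite xy' eqxx in xy].
Qed.

Lemma Sn_not_fully_realizable n : 2 < n -> n != 5 -> ~ fully_realizable 'S_n.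
Proof.
move=> n2 n5 frS.
pose o k (kn : k < 3) := Ordinal (leq_trans kn n2).
pose o0 := @o 0 isT; pose o1 := @o 1 isT; pose o2 := @o 2 isT.
have o01 : o0 != o1 by []. have o02 : o0 != o2 by []. have o12 : o1 != o2 by [].
pose a : 'S_n := tperm o0 o1; pose b : 'S_n := tperm o1 o2.
have aV : (a^-1 = a)%g by exact: tpermV.
have bV : (b^-1 = b)%g by exact: tpermV.
have a2 : (a * a = 1)%g by exact: tperm2.
have b2 : (b * b = 1)%g by exact: tperm2.
have ab3 : ((a * b) ^+ 3 = 1)%g.
  (* Both sides are the transposition of [o0] and [o2]. *)
  have braid : (a * b * a = b * a * b)%g.
    have -> : (a * b * a = b ^ a)%g by rewrite conjgE aV mulgA.
    have -> : (b * a * b = a ^ b)%g by rewrite conjgE bV mulgA.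
    by rewrite /a /b !tpermJ !(tpermL, tpermR) (tpermD o02 o12) tpermD.
  by rewrite !expgS expg0 mulg1 !mulgA braid -!mulgA (mulgA b b) b2 mul1g
     (mulgA a a) a2 mul1g.
have oc : odd #[(a * b)%g]%g by apply: dvdn_odd (_ : odd 3); rewrite // order_dvdn ab3.
have Na : a \in 'N(<[a * b]>)%g.
  rewrite -cycle_subG norms_cycle.
  suff -> : ((a * b) ^ a = (a * b)^-1)%g by rewrite groupV cycle_id.
  by rewrite conjgE invMg aV bV !mulgA a2 mul1g.
have oa : odd_perm a by rewrite odd_tperm.
have n1 : 1 < n by exact: ltnW.
have [z oz zC] := fully_realizable_Sn_odd n1 frS oc Na oa.
have za : commute z a by apply: zC; rewrite // commgg group1.
have zab : commute z (a * b)%g.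
  apply: zC; first by rewrite (subsetP (normG _)) // cycle_id.
  by rewrite commgEl groupM ?groupV ?cycle_id // memJ_norm ?cycle_id.
have zb : commute z b.
  by rewrite -[b](mulKg a); apply: commuteM => //; apply: commuteV.
have o10 : o1 != o0 by []. have o21 : o2 != o1 by [].
(* The supports of [a] and [b] are preserved by [z] and meet only in [o1]. *)
have z1 : z o1 = o1.
  have zb1 := commute_tperm o12 zb.
  have := za; rewrite /a tpermC => /(commute_tperm o10)[//|z10].
  by case: zb1 => //; rewrite z10.
have z0 : z o0 = o0.
  by case: (commute_tperm o01 za) => //;
    rewrite -{1}z1 => /perm_inj e; rewrite e eqxx in o01.
have z2 : z o2 = o2.
  have := zb; rewrite /b tpermC => /(commute_tperm o21)[//|].
  by rewrite -{1}z1 => /perm_inj e; rewrite e eqxx in o12.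
have zxy x y : x != y -> x \notin [:: o0; o1; o2] -> y \notin [:: o0; o1; o2] ->
    z x = x \/ z x = y.
  rewrite !inE !negb_or => xy /and3P[x0 x1 x2] /and3P[y0 y1 y2].
  apply: commute_tperm => //; have ta : commute (tperm x y) a.
    rewrite /commute conjgC; congr (_ * _)%g.
    by rewrite /a tpermJ !tpermD // eq_sym.
  have tb : commute (tperm x y) b.
    rewrite /commute conjgC; congr (_ * _)%g.
    by rewrite /b tpermJ !tpermD // eq_sym.
  apply: zC; last first.
    suff -> : [~ tperm x y, a]%g = 1%g by exact: group1.
    by apply/eqP/commgP.
  apply: (subsetP (cent_sub _)); rewrite cent_cycle; apply/cent1P.
  by apply: commuteM.
suff z_id : z = 1%g by rewrite z_id odd_perm1 in oz.
apply/permP => x; rewrite perm1; apply/eqP/negPn/negP => zx.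
have xU : x \notin [:: o0; o1; o2].
  by rewrite !inE; apply: contra zx => /or3P[] /eqP->; apply/eqP.
have zxU : z x \notin [:: o0; o1; o2].
  rewrite !inE; apply: contra xU; rewrite !inE -{1}z0 -{1}z1 -{1}z2.
  by rewrite !(inj_eq perm_inj).
(* If z moves x, then z x, x, o0, o1, o2 are distinct, so n > 5 and there is a
   further point y; but z also preserves {x, y}. *)
pose s := [:: z x; x; o0; o1; o2].
have us : uniq s by rewrite /s 2!cons_uniq inE negb_or zx xU zxU.
have cs : #|s| = 5 by apply/card_uniqP.
have s_n : #|s| < #|'I_n|.
  by rewrite ltn_neqAle max_card card_ord cs eq_sym n5.
have /subsetPn[y _] : ~~ ('I_n \subset s).
  by apply: contraL s_n => /subset_leq_card; rewrite -leqNgt.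
rewrite !inE !negb_or => /and3P[yzx yx yo].
have xy : x != y by rewrite eq_sym.
have [||/eqP|/eqP] := zxy x y xy => //; first by rewrite !inE !negb_or.
  by rewrite (negPf zx).
by rewrite eq_sym (negPf yzx).
Qed.

(** With a 3-cycle, [z] could here be the transposition of the two remaining letters, which is odd;
    hence the change of subgroup. *)
Lemma S5_not_fully_realizable : ~ fully_realizable 'S_5.
Proof.
move=> frS.
(* The letters form Z/5: [c] is translation by 1, and [g] is doubling, the 4-cycle 1, 2, 4, 3. *)
pose c : 'S_5 := perm (addrI (1%R : 'I_5)).
have cE x : c x = (1 + x)%R by rewrite permE.
have inj2 : injective (fun x : 'I_5 => x + x)%R.
  by move=> x y /eqP exy; apply/eqP; move: x y exy; do 2!case=> [[|[|[|[|[|?]]]]] ?].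
pose g : 'S_5 := perm inj2.
have cX k x : (c ^+ k)%g x = (k%:R + x)%R.
  by elim: k x => [|k IHk] x; rewrite ?perm1 ?add0r // expgS permM IHk cE addrA -natr1.
have oc : odd #[c]%g.
  apply: dvdn_odd (_ : odd 5); rewrite // order_dvdn; apply/eqP/permP=> x.
  by rewrite cX perm1; apply/eqP; case: x => [[|[|[|[|[|?]]]]] ?].
have cg : (c ^ g = c ^+ 2)%g.
  apply: (mulgI g); rewrite -conjgC; apply/permP => x.
  rewrite (permM c) (permM g) cX cE !permE.
  by apply/eqP; case: x => [[|[|[|[|[|?]]]]] ?].
have Ng : g \in 'N(<[c]>)%g by rewrite -cycle_subG norms_cycle cg mem_cycle.
have og : odd_perm g.
  have -> : g = (tperm 1%R 2%R * tperm 1%R 4%R * tperm 1%R 3%R)%g.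
    by apply/permP => x; rewrite !permM !permE; apply/eqP;
      case: x => [[|[|[|[|[|?]]]]] ?].
  by rewrite !odd_permM !odd_tperm.
have [z oz zC] := fully_realizable_Sn_odd (n := 5) isT frS oc Ng og.
have zc : commute z c.
  apply: zC; first by rewrite (subsetP (normG _)) // cycle_id.
  by rewrite commgEl groupM ?groupV ?cycle_id // memJ_norm ?cycle_id.
(* Commuting with [c] makes [z] the translation by its value at 0, so its order is odd and it is
   even. *)
suff zE : z = (c ^+ z 0%R)%g.
  move: oz; rewrite zE odd_perm_odd_order //.
  by apply: dvdn_odd (orderXdvd _ _) oc.
apply/permP=> x; have xE : x = (c ^+ x)%g 0%R by rewrite cX natr_Zp addr0.
by rewrite {1}xE -permM -(commuteX x zc) permM !cX !natr_Zp addrC.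
Qed.

(** * Dual numbers and their rescalings *)

Section DualNumbers.

Local Open Scope ring_scope.

Variable R : comPzRingType.

(* The pair (a, b) stands for a + b x in R[x]/(x^2). *)
Definition dual : Type := (R * R)%type.

HB.instance Definition _ := GRing.Zmodule.on dual.

Definition dual_one : dual := (1, 0).
Definition dual_mul (x y : dual) : dual := (x.1 * y.1, x.1 * y.2 + x.2 * y.1).

Fact dual_mulA : associative dual_mul.
Proof.
by move=> [a b] [c d] [e f]; rewrite /dual_mul /= mulrDr mulrDl !mulrA addrA.
Qed.

Fact dual_mul1l : left_id dual_one dual_mul.
Proof. by move=> [a b]; rewrite /dual_mul /= !mul1r mul0r addr0. Qed.

Fact dual_mulC : commutative dual_mul.
Proof.
by move=> [a b] [c d]; rewrite /dual_mul /= mulrC addrC ![_ * a]mulrC ![_ * c]mulrC.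
Qed.

Fact dual_mulDl : left_distributive dual_mul +%R.
Proof.
move=> [a b] [c d] [e f]; congr (_, _); rewrite /= ?mulrDl //.
by rewrite addrACA.
Qed.

HB.instance Definition _ := GRing.Zmodule_isComPzRing.Build dual
  dual_mulA dual_mulC dual_mul1l dual_mulDl.

(** This is the substitution of [k] x for x, compatible with x^2 = 0. The values 0 and 1 of [k]
    serve for the two endomorphisms of ['S_2]. *)
Definition dual_scale (k : R) (x : dual) : dual := (x.1, k * x.2).

Fact dual_scale_is_zmod_morphism k : zmod_morphism (dual_scale k).
Proof. by move=> [a b] [c d]; rewrite /dual_scale /= mulrBr; congr (_, _). Qed.

Fact dual_scale_is_monoid_morphism k : monoid_morphism (dual_scale k).
Proof.
split=> [|[a b] [c d]]; rewrite /dual_scale /= ?mulr0 //; congr (_, _).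
by rewrite /= mulrDr mulrCA (mulrA k b).
Qed.

HB.instance Definition _ k :=
  GRing.isZmodMorphism.Build dual dual (dual_scale k) (dual_scale_is_zmod_morphism k).
HB.instance Definition _ k :=
  GRing.isMonoidMorphism.Build dual dual (dual_scale k) (dual_scale_is_monoid_morphism k).

End DualNumbers.

(** * Realization of the symmetric groups on one and two letters *)

Section SmallSymmetricGroups.

Local Open Scope ring_scope.

Lemma S1_fully_realizable : fully_realizable 'S_1.
Proof.
have S1 (x y : 'S_1) : x = y by apply/permP => j; rewrite !ord1.
exists ('F_2 : pzRingType), (fun=> 1); split.
  split=> [x y|x y _|r]; rewrite ?mulr1 //.
  split=> [[s [rs _]]|[_ <-]]; last by exists 1; rewrite mulr1.
  exists 1%g; apply/eqP; move: rs; case: r s => [[|[|?]] ?] [[|[|?]] ?] // /eqP.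
by move=> f; exists idfun.
Qed.

Lemma S2_fully_realizable : fully_realizable 'S_2.
Proof.
have S2 (x : 'S_2) : x = if odd_perm x then tperm 0 1 else 1%g.
  have I2 (j : 'I_2) : j != 0 -> j = 1 by case: j => [[|[|?]] ?] // _; apply/eqP.
  have x1 : x 1 != x 0 by rewrite (inj_eq perm_inj).
  have [x0|/I2 x0] := eqVneq (x 0) 0.
    suff -> : x = 1%g by rewrite odd_perm1.
    apply/permP => j; rewrite perm1; have [->//|/I2 ->] := eqVneq j 0.
    by apply: I2; rewrite -x0.
  suff -> : x = tperm 0 1 by rewrite odd_tperm.
  apply/permP => j; have [->|/I2 ->] := eqVneq j 0; first by rewrite tpermL.
  rewrite tpermR; apply/eqP; apply: contraNT x1 => /I2 ->.
  by rewrite x0.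
(* The units are 1 and 1 + x; the transposition corresponds to 1 + x. *)
exists (dual 'F_2 : pzRingType), (fun x : 'S_2 => (1, (odd_perm x)%:R)); split.
  split=> [x y|x y /= [] |r].
  - congr (_, _); rewrite /= ?mulr1 ?mul1r //.
    by rewrite odd_permM; apply/eqP; do 2!case: odd_perm.
  - suff exy : (odd_perm x)%:R = (odd_perm y)%:R :> 'F_2 -> odd_perm x = odd_perm y.
      by move/exy => oxy; rewrite (S2 x) (S2 y) oxy.
    by do 2!case: odd_perm.
  - split=> [[s [[rs _] _]]|[x <-]]; last first.
      exists (1, (odd_perm x)%:R).
      by split; apply/eqP; case: odd_perm.
    case: r s rs => a b [c d] /= ac.
    have -> : a = 1 by apply/eqP; move/eqP: ac; case: a c => [[|[|?]] ?] [[|[|?]] ?].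
    exists (if b == 0 then 1%g else tperm 0 1).
    congr (_, _); apply/eqP; case: (eqVneq b 0) => [->|b0].
      by rewrite odd_perm1.
    by rewrite odd_tperm; case: b b0 => [[|[|?]] ?].
move=> f.
(* An endomorphism [f] is determined by whether it fixes or kills the transposition, which gives the
   scalar 1 or 0. *)
exists (dual_scale (odd_perm (f (tperm 0 1)))%:R : {rmorphism dual 'F_2 -> dual 'F_2}).
move=> x; congr (_, _); rewrite /= [in f x](S2 x).
have f1 : f 1%g = 1%g by apply: (mulgI (f 1%g)); rewrite -gmulfM !mulg1.
by case: (odd_perm x); rewrite ?f1 ?odd_perm1 ?mulr1 ?mulr0.
Qed.

End SmallSymmetricGroups.

(** * Simplicity, and the equivalence *)

Lemma Sn_not_simple n : 2 < n -> ~ ([set: 'S_n]%g = 1%g \/ simple [set: 'S_n]%g).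
Proof.
move=> n2; have nfact : 2 < n`!.
  by apply: leq_trans (ltn_fact _ n2).
have nT : #|'I_n| = n by rewrite card_ord.
have cA : 2 * #|('Alt_('I_n))%g| = n`! by rewrite card_Alt ?nT // ltnW.
case=> [S1|/simpleP[_ sS]].
  by have := card_Sn n; rewrite -cardsT S1 cards1 => e; rewrite -e in nfact.
(* The alternating group has index 2: were it trivial, [n!] would be 2, and it cannot be the whole
   group. *)
have [A1|AS] := sS _ (Alt_normal 'I_n).
  by rewrite A1 cards1 in cA; rewrite -cA in nfact.
move: cA; rewrite AS cardsT card_Sn => /eqP.
by rewrite -[X in _ == X]mul1n eqn_pmul2r ?fact_gt0.
Qed.

(* The library's simple excludes the trivial group; the case n = 1 of (3) is to
   be read with the trivial group allowed, hence the first disjunct. *)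
Theorem theorem7p1 (n : nat) (hn : 0 < n) :
  [<-> n = 1 \/ n = 2;
       fully_realizable 'S_n;
       [set: 'S_n]%g = 1%g \/ simple [set: 'S_n]%g].
Proof.
tfae.
- by case=> ->; [exact: S1_fully_realizable | exact: S2_fully_realizable].
(* Full realizability leaves only [n] equal to 1 or 2, where the group is trivial or of prime
   order. *)
- case: n hn => [|[|[|n]]] // _ frS.
  + by left; apply/eqP; rewrite trivg_card1 cardsT card_Sn.
  + right; apply/simpleP; split; first by rewrite trivg_card1 cardsT card_Sn.
    move=> H /normal_sub /cardSg; rewrite cardsT card_Sn.
    move=> /(primeP (isT : prime 2)).2.
    case/orP=> /eqP cH; [left; exact: card1_trivg | right].
    by apply/eqP; rewrite eqEcard subsetT cardsT card_Sn cH.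
  + have [n5|n5] := eqVneq n.+3 5;
      last by case: (@Sn_not_fully_realizable n.+3).
    by case: S5_not_fully_realizable; rewrite -n5.
- by case: n hn => [|[|[|n]]] // _; [left | right | move/(@Sn_not_simple n.+3 isT)].
Qed.
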